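(* Let $a, b, n$ be nonnegative integers with $a>b\ge 1$. Then: (i) If $n\ge 2$, then $$\nu_2\big(S(a2^{n},3)-S(b2^n, 3)\big) \begin{cases} = n+1+\nu_2(a-b) & \text{if } b2^n>n+2+\nu_2(a-b),\\ > n+1+\nu_2(a-b) & \text{if } b2^n=n+2+\nu_2(a-b),\\ = b2^n-1 & \text{if } b2^n<n+2+\nu_2(a-b).\end{cases}$$ (ii) If $n\ge 3$, then $$\nu_2\big(S(a2^{n},7)-S(b2^n, 7)\big) \begin{cases} = n+1+\nu_2(a-b) & \text{if } b2^n>n+3+\nu_2(a-b),\\ > n+1+\nu_2(a-b) & \text{if } b2^n=n+3+\nu_2(a-b),\\ = b2^n-2 & \text{if } b2^n<n+3+\nu_2(a-b).\end{cases}$$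
   Context: $S(n,k)$ denotes the Stirling number of the second kind (the number of partitions of an $n$-element set into exactly $k$ nonempty blocks). For a nonzero integer $m$, $\nu_2(m)$ denotes the 2-adic valuation of $m$, i.e. the exponent of the largest power of $2$ dividing $m$. *)

(* Defs.v *)
From mathcomp Require Import all_boot all_order all_algebra.

Set Implicit Arguments.
Unset Strict Implicit.
Unset Printing Implicit Defensive.

(* [partition P D] already requires the blocks to be nonempty. *)
Definition stirling2 (n k : nat) : nat :=
  #|[set P : {set {set 'I_n}} | partition P [set: 'I_n] & #|P| == k]|.

(* Meaningful for m <> 0 only: nu2 0 = 0 by convention of [logn], so any
   statement that nu2 m is positive entails m <> 0. *)
Definition nu2 (m : int) : nat := logn 2 `|m|%N.

(* Main.v *)
(* Sorting the functions from an n-set to a k-set by their kernels gives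
   k^n = sum_j k^_j S(n, j), hence explicit formulas for 3! S(n, 3) and 7! S(n, 7)
   as combinations of n-th powers.  When 8 divides N, the terms of 7! S(N, 7) with
   even bases sum to a number of valuation exactly N + 2.  For the odd bases j put
   y = j^8 = 1 mod 32: then y^(k+d) - y^k = d (y - 1) mod 2^(nu2 d + 9), and the
   relevant combination of the numbers y - 1 is 2^8 times an odd number, so the
   odd bases contribute valuation exactly nu2 d + 8 to the difference.  The three
   cases compare these two valuations.  S(N, 3) is treated similarly with y = 3^4.
   When the valuations coincide one also needs that the difference is nonzero:
   S(n, k) is strictly increasing in n >= k for k > 1. *)
Require Import Defs.
From mathcomp Require Import all_boot all_order all_algebra.
From mathcomp Require Import ring zify.
Import GRing.Theory.

(** * Functions counted by their kernels *)

Lemma preim_partition_eqP (T : finType) (rT : eqType) (f : T -> rT)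
    (P : {set {set T}}) :
  partition P [set: T] ->
  reflect (forall x y, (f x == f y) = (pblock P x == pblock P y))
          (preim_partition f [set: T] == P).
Proof.
move=> partP; have [/eqP covP tiP _] := and3P partP.
have eq_blk x y : (pblock P x == pblock P y) = (y \in pblock P x).
  by rewrite eq_pblock // covP inE.
apply: (iffP eqP) => [defP x y | eqf].
  rewrite eq_blk -defP pblock_equivalence_partition ?inE //.
  by split=> // /eqP->.
rewrite -[RHS](equivalence_partition_pblock partP).
by apply: eq_imset => x; apply/setP=> y; rewrite !inE /= eqf eq_blk.
Qed.

(** A function with kernel [P] factors uniquely through the map sending x to its block, and the
    induced map on blocks is injective; so such functions correspond to injections from [P] to
    [rT]. *)
Lemma card_preim_partition (T rT : finType) (P : {set {set T}}) :
  partition P [set: T] ->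
  #|[set f : {ffun T -> rT} | preim_partition f [set: T] == P]|
    = #|rT| ^_ #|P|.
Proof.
move=> partP; have [/eqP covP tiP nP0] := and3P partP.
have blkP x : pblock P x \in P by rewrite pblock_mem // covP inE.
pose blk x : {B | B \in P} := Sub (pblock P x) (blkP x).
have blk_onto B : exists x, blk x == B.
  have [x xB] : exists x, x \in val B.
    by apply/set0Pn; apply: contraNneq nP0 => <-; apply: (valP B).
  by exists x; apply/eqP; apply: val_inj; apply: (def_pblock tiP (valP B) xB).
pose pull (g : {ffun {B | B \in P} -> rT}) : {ffun T -> rT} :=
  [ffun x => g (blk x)].
have pull_inj : injective pull.
  move=> g h eq_gh; apply/ffunP=> B; have [x /eqP <-] := blk_onto B.
  by have /ffunP/(_ x) := eq_gh; rewrite !ffunE.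
rewrite -[#|P|]card_sig -card_inj_ffuns -(card_imset _ pull_inj).
apply: eq_card => f; rewrite inE; apply/(preim_partition_eqP _ _ _ _ partP)/imsetP.
  move=> eqf; exists [ffun B => f (xchoose (blk_onto B))]; last first.
    apply/ffunP=> x; rewrite !ffunE; apply/eqP; rewrite eqf.
    by have /eqP/(congr1 val)/= -> := xchooseP (blk_onto (blk x)).
  rewrite inE; apply/injectiveP=> B C; rewrite !ffunE => /eqP; rewrite eqf => /eqP.
  have /eqP/(congr1 val)/= -> := xchooseP (blk_onto B).
  have /eqP/(congr1 val)/= -> := xchooseP (blk_onto C).
  exact: val_inj.
case=> g; rewrite inE => /injectiveP g_inj -> x y.
by rewrite !ffunE (inj_eq g_inj).
Qed.

Lemma expn_stirling2 n k :
  k ^ n = \sum_(j < k.+1) k ^_ j * stirling2 n j.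
Proof.
have -> : k ^ n = #|{ffun 'I_n -> 'I_k}| by rewrite card_ffun !card_ord.
rewrite -sum1_card.
rewrite (partition_big (fun f : {ffun 'I_n -> 'I_k} => preim_partition f [set: 'I_n])
  (fun P => partition P [set: 'I_n])) /=; last by move=> f _; apply: preim_partitionP.
rewrite (eq_bigr (fun P : {set {set 'I_n}} => k ^_ #|P|)); last first.
  by move=> P partP; rewrite sum1dep_card card_preim_partition // card_ord.
(* Partitions with more than k blocks contribute [k ^_ #|P| = 0]. Once they are dropped, [inord]
   records the number of blocks faithfully. *)
rewrite (bigID (fun P : {set {set 'I_n}} => #|P| < k.+1)) /=.
rewrite [X in _ + X]big1 ?addn0; last first.
  by move=> P /andP[_]; rewrite -leqNgt => /ffact_small.
rewrite (partition_big (fun P : {set {set 'I_n}} => inord #|P| : 'I_k.+1) predT) //=.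
apply: eq_bigr => j _; rewrite mulnC -sum_nat_const.
apply: eq_big => P.
  rewrite inE; case: (partition _ _) => //=.
  apply/andP/eqP => [[ltP /eqP <-]|cP]; first by rewrite inordK.
  by rewrite cP ltn_ord inord_val.
by case/andP=> /andP[_ ltP] /eqP <-; rewrite inordK.
Qed.

(** * Recurrence and strict monotonicity in n *)

Lemma mul_ffact k j : k * k ^_ j = k ^_ j.+1 + j * k ^_ j.
Proof.
rewrite ffactnSr mulnC [j * _]mulnC -mulnDr.
have [lejk|ltkj] := leqP j k; first by rewrite subnK.
by rewrite ffact_small.
Qed.

(* Both sides have the same sums against the triangular array [k ^_ j]. *)
Lemma stirling2S n k :
  stirling2 n.+1 k.+1 = k.+1 * stirling2 n k.+1 + stirling2 n k.
Proof.
pose b j := j * stirling2 n j + (if j is i.+1 then stirling2 n i else 0).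
suff eqb j : stirling2 n.+1 j = b j by exact: eqb k.+1.
elim/ltn_ind: j => j IH.
have: \sum_(i < j.+1) j ^_ i * stirling2 n.+1 i = \sum_(i < j.+1) j ^_ i * b i.
  (* The left sum is j * j^n; [mul_ffact] expands each j * [j ^_ i] in falling factorials, and
     shifting one of the two resulting sums gives [b]. *)
  rewrite -expn_stirling2 expnS expn_stirling2 big_distrr /=.
  under eq_bigr => i _ do rewrite mulnA mul_ffact mulnDl.
  under [RHS]eq_bigr => i _ do rewrite /b mulnDr mulnA [_ * val i]mulnC.
  rewrite !big_split /= addnC; congr (_ + _).
  by rewrite [RHS]big_ord_recl muln0 add0n big_ord_recr /= ffact_small ?addn0.
(* The lower terms agree by induction, and the diagonal coefficient [j ^_ j] is positive, so it
   cancels. *)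
rewrite !big_ord_recr /= (eq_bigr (fun i : 'I_j => j ^_ i * b i)) => [/eqP|i _];
  last by rewrite IH.
by rewrite eqn_add2l eqn_pmul2l ?ffact_gt0 // => /eqP.
Qed.

Lemma stirling2_n0 n : stirling2 n 0 = (n == 0).
Proof.
have := expn_stirling2 n 0; rewrite big_ord1 ffactn0 mul1n => <-.
by case: n => // n; rewrite exp0n.
Qed.

Lemma stirling2_gt0 n k : 0 < k <= n -> 0 < stirling2 n k.
Proof.
elim: n k => [|n IH] [|k] //= lekn; rewrite stirling2S addn_gt0.
case: k lekn => [_|k lekn]; last by rewrite (IH k.+1) ?orbT.
by case: n IH => [|n] IH; [rewrite stirling2_n0 orbT | rewrite muln_gt0 IH].
Qed.

Lemma ltn_stirling2 k m n : 1 < k <= m -> m < n -> stirling2 m k < stirling2 n k.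
Proof.
move=> /andP[k_gt1 lekm].
have step i : k <= i -> stirling2 i k < stirling2 i.+1 k.
  case: k k_gt1 {lekm} => // k k_gt0 leki; rewrite stirling2S ltn_addr //.
  by rewrite -[ltnLHS]mul1n ltn_pmul2r // stirling2_gt0.
elim: n => // n IH; rewrite ltnS leq_eqVlt => /predU1P[<-|ltmn]; first exact: step.
by apply: ltn_trans (IH ltmn) (step _ _); lia.
Qed.

(** * Explicit formulas for k = 3 and k = 7 *)

Lemma stirling2_3 n : 0 < n -> 3`! * stirling2 n 3 + 3 * 2 ^ n = 3 ^ n + 3.
Proof.
(* For a successor the S(n, 0) terms vanish, and the expansions of 1^n, 2^n and 3^n form a
   triangular linear system. *)
case: n => // n _.
have := expn_stirling2 n.+1 1; have := expn_stirling2 n.+1 2.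
have := expn_stirling2 n.+1 3.
rewrite !big_ord_recr !big_ord0 /= exp1n !factS ?fact0 !ffactnS !ffactn0 !stirling2_n0 /=.
lia.
Qed.

Lemma stirling2_7 n : 0 < n ->
  7`! * stirling2 n 7 + 7 * 6 ^ n + 35 * 4 ^ n + 21 * 2 ^ n
  = 7 ^ n + 21 * 5 ^ n + 35 * 3 ^ n + 7.
Proof.
case: n => // n _.
have := expn_stirling2 n.+1 1; have := expn_stirling2 n.+1 2.
have := expn_stirling2 n.+1 3.
have := expn_stirling2 n.+1 4; have := expn_stirling2 n.+1 5.
have := expn_stirling2 n.+1 6; have := expn_stirling2 n.+1 7.
rewrite !big_ord_recr !big_ord0 /= exp1n !factS ?fact0 !ffactnS !ffactn0 !stirling2_n0 /=.
lia.
Qed.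

(** * Exact powers of 2 dividing an integer *)

Local Open Scope ring_scope.

(** The explicit odd cofactor lets [ring] check witnesses, and it forces x to be nonzero, which an
    equation [nu2 x = v] would not. *)
Definition exact2 (v : nat) (x : int) : Prop :=
  exists q : int, x = 2 ^+ v * (2 * q + 1).

Lemma nu2_exact2 v x : exact2 v x -> nu2 x = v.
Proof.
case=> q ->; rewrite /nu2 abszM abszX lognM ?expn_gt0 //; last by lia.
rewrite pfactorK // lognE.
by case: ifP => [/and3P[_ _]|_]; rewrite ?addn0 // dvdn2; lia.
Qed.

Lemma dvdz_leq_nu2 v (x : int) : x != 0 -> (2 ^+ v %| x)%Z -> (v <= nu2 x)%N.
Proof. by move=> x0; rewrite dvdzE abszX /nu2 -pfactor_dvdn // absz_gt0. Qed.

Lemma exact2D v x y : exact2 v x -> (2 ^+ v.+1 %| y)%Z -> exact2 v (x + y).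
Proof.
by case=> p -> /dvdzP[q ->]; exists (p + q); rewrite exprS; ring.
Qed.

Lemma exact2_dvd v w x : exact2 w x -> (v <= w)%N -> (2 ^+ v %| x)%Z.
Proof. by case=> q -> levw; rewrite dvdz_mulr // dvdz_exp2l. Qed.

Lemma exact2N v x : exact2 v x -> exact2 v (- x).
Proof. by case=> q ->; exists (- q - 1); ring. Qed.

Lemma exact2D_eq v x y : exact2 v x -> exact2 v y -> (2 ^+ v.+1 %| x + y)%Z.
Proof.
by case=> p -> [q ->]; apply/dvdzP; exists (p + q + 1); rewrite exprS; ring.
Qed.

Lemma dvdz_exact2_cancel v w x y :
  exact2 w x -> (2 ^+ (v + w) %| x * y)%Z -> (2 ^+ v %| y)%Z.
Proof.
case=> p ->; rewrite addnC exprD -mulrA dvdz_mul2l ?expf_neq0 //=.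
by rewrite Gauss_dvdzr // coprimezXl // coprimezE coprime2n; lia.
Qed.

Lemma exact2_cancel v w x y : exact2 w x -> exact2 (v + w) (x * y) -> exact2 v y.
Proof.
move=> xw xyvw; have /dvdzP[z def_y] : (2 ^+ v %| y)%Z.
  by apply: dvdz_exact2_cancel xw (exact2_dvd _ _ _ xyvw _).
case: xw xyvw => p -> [q]; rewrite def_y addnC exprD.
have ->: 2 ^+ w * (2 * p + 1) * (z * 2 ^+ v)
  = 2 ^+ w * 2 ^+ v * ((2 * p + 1) * z) by ring.
move/mulfI => /(_ _)/= eq_z; exists (q - p * z).
have {}eq_z := eq_z (mulf_neq0 (expf_neq0 _ _) (expf_neq0 _ _)).
rewrite mulrC; congr (_ * _); have := eq_z isT isT; lia.
Qed.

(** Meant for K a factorial, D a difference of Stirling numbers, and U, V the contributions of the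
    odd and even bases to K * D. *)
Lemma nu2_trichotomy (k u v : nat) (K D U V : int) :
    exact2 k K -> D != 0 -> (k <= u)%N -> exact2 u U -> (k <= v)%N -> exact2 v V ->
    K * D = U + V ->
  [/\ (u < v)%N -> nu2 D = (u - k)%N, u = v -> (u - k < nu2 D)%N
    & (v < u)%N -> nu2 D = (v - k)%N].
Proof.
move=> exK D0 leku exU lekv exV defKD; split=> [ltuv | eq_uv | ltvu].
- apply/nu2_exact2/(exact2_cancel _ _ _ _ exK); rewrite subnK // defKD.
  exact: exact2D exU (exact2_dvd _ _ _ exV ltuv).
- apply: dvdz_leq_nu2 D0 (dvdz_exact2_cancel _ _ _ _ exK _).
  by rewrite defKD addSn subnK // exact2D_eq // eq_uv.
- apply/nu2_exact2/(exact2_cancel _ _ _ _ exK); rewrite subnK // defKD addrC.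
  exact: exact2D exV (exact2_dvd _ _ _ exU ltvu).
Qed.

(** * Powers of integers congruent to 1 modulo a power of 2 *)

Lemma expr_taylor1 (t : nat) (z : int) :
  exists r, (1 + z) ^+ t = 1 + t%:Z * z + z ^+ 2 * r.
Proof.
elim: t => [|t [r IH]]; first by exists 0; rewrite expr0; ring.
by exists (t%:Z + r + z * r); rewrite exprS IH intS; ring.
Qed.

(* Doubling the exponent gains a factor 2 in the first-order error as well. *)
Lemma expr_sub1_linear (c s t : nat) (u : int) :
  exists q r : int,
   (1 + 2 ^+ c.+1 * u) ^+ (2 ^ s * t)%N = 1 + 2 ^+ (s + c.+1) * q /\
   (1 + 2 ^+ c.+1 * u) ^+ (2 ^ s * t)%N
     = 1 + (2 ^ s * t)%N%:Z * (2 ^+ c.+1 * u) + 2 ^+ (s + c.*2.+1) * r.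
Proof.
elim: s => [|s [q [r [IHq IHr]]]].
  rewrite mul1n !add0n; have [r def_y] := expr_taylor1 t (2 ^+ c.+1 * u).
  exists (t%:Z * u + 2 ^+ c.+1 * u ^+ 2 * r), (2 * u ^+ 2 * r).
  rewrite def_y -addnn !exprS exprD; split; ring.
rewrite expnS -mulnA mulnC exprM.
exists (q + 2 ^+ (s + c) * q ^+ 2), (r + 2 ^+ s * q ^+ 2); split.
  by rewrite IHq !addnS !addSn !exprS !exprD; ring.
have sqrE (Y : int) : Y ^+ 2 = 2 * Y - 1 + (Y - 1) ^+ 2 by ring.
rewrite sqrE.
(* The fine expansion goes into the linear term; the coarse one suffices for the square, whose size
   2^(2s+2c+2) is absorbed by the new error 2^(s+2c+2). *)
rewrite {1}IHr IHq -addnn PoszM.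
by rewrite !addnS !addSn !exprS !exprD; ring.
Qed.

(** The common factor y^k is 1 mod 2^(c+1), while the other factor is divisible by 2^(s+c+1);
    replacing y^k by 1 thus costs only a multiple of 2^(s+2c+2). *)
Lemma expr_diff_linear (c s t k : nat) (u : int) :
  exists r : int,
   (1 + 2 ^+ c.+1 * u) ^+ (k + 2 ^ s * t)%N - (1 + 2 ^+ c.+1 * u) ^+ k
     = 2 ^+ s * t%:Z * (2 ^+ c.+1 * u) + 2 ^+ (s + c.*2.+1) * r.
Proof.
have [q [r [def_q def_r]]] := expr_sub1_linear c s t u.
have [p [_ [def_p _]]] := expr_sub1_linear c 0 k u.
rewrite mul1n add0n in def_p; exists (r + 2 * p * q).
rewrite exprD -[X in _ - X]mulr1 -mulrBr.
have mul_sub1 (Y Z : int) : Y * (Z - 1) = (Z - 1) + (Y - 1) * (Z - 1) by ring.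
rewrite mul_sub1 {1}def_r def_q def_p PoszM -(natz (2 ^ s)) natrX -addnn.
by rewrite !addnS !exprS !exprD; ring.
Qed.

(** * Valuations of the even-base and odd-base parts *)

Lemma even_part7_exact2 N : (4 <= N)%N -> ~~ odd N ->
  exact2 N.+2 (7 * 6 ^+ N + 35 * 4 ^+ N + 21 * 2 ^+ N).
Proof.
move=> N_ge4 evN; have [M def_N] : exists M, N = (M.+2).*2 by exists (N./2 - 2)%N; lia.
have [r def_3N] : exists r : int, 3 ^+ N = 1 + 8 * r.
  have [r def_r] := expr_taylor1 M.+2 8; exists (M.+2%:Z + 8 * r).
  by rewrite def_N -muln2 mulnC exprM [3 ^+ 2](_ : _ = 1 + 8) // def_r; ring.
have def_2N : 2 ^+ N = 16 * 2 ^+ (N - 4) :> int.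
  by rewrite -(exprD 2 4) subnKC.
(* Divided by 2^N the sum is 7 * 3^N + 21 + 35 * 2^N, which is 28 mod 8, that is, 4 times an odd
   number. *)
exists (3 + 7 * r + 35 * 2 * 2 ^+ (N - 4)).
have [-> ->] : (6%:R = 2 * 3 :> int) /\ (4%:R = 2 * 2 :> int) by [].
rewrite !exprMn def_3N !exprS {3}def_2N.
ring.
Qed.

Lemma odd_part7_exact2 s t k : odd t ->
  let F N : int := 7 ^+ N + 21 * 5 ^+ N + 35 * 3 ^+ N in
  exact2 (s + 8) (F (8 * (k + 2 ^ s * t))%N - F (8 * k)%N).
Proof.
move=> odd_t F; rewrite /F !exprM.
(* The bases are kept abstract so that no large power is ever computed. *)
have linear (y7 y5 y3 u7 u5 u3 : int) :
    y7 = 1 + 2 ^+ 5 * u7 -> y5 = 1 + 2 ^+ 5 * u5 -> y3 = 1 + 2 ^+ 5 * u3 ->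
  let G N := y7 ^+ N + 21 * y5 ^+ N + 35 * y3 ^+ N in
  exists r, G (k + 2 ^ s * t)%N - G k =
    2 ^+ s * (t%:Z * 2 ^+ 5 * (u7 + 21 * u5 + 35 * u3) + 2 ^+ 9 * r).
  move=> -> -> -> /=.
  have [r7 def7] := expr_diff_linear 4 s t k u7.
  have [r5 def5] := expr_diff_linear 4 s t k u5.
  have [r3 def3] := expr_diff_linear 4 s t k u3.
  exists (r7 + 21 * r5 + 35 * r3).
  have regroup (a b c a' b' c' : int) :
    (a' + 21 * b' + 35 * c') - (a + 21 * b + 35 * c)
      = (a' - a) + 21 * (b' - b) + 35 * (c' - c) by ring.
  by rewrite regroup def7 def5 def3 !exprD -[4.*2.+1]/9%N; ring.
(* [(7 ^ 8 - 1) / 32], [(5 ^ 8 - 1) / 32] and [(3 ^ 8 - 1) / 32], factored because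
   literals above 5000 are opaque to [ring]. *)
have [|||r ->] := linear (7 ^+ 8) (5 ^+ 8) (3 ^+ 8) (50 * 3603) (3 * 4069) 205;
  try ring.
have [m ->] : exists m, t = m.*2.+1 by exists t./2; move: odd_t; clear; lia.
(* The weighted sum of the three quotients is 8 * 31 * 1789, and 3081 * 9 is (31 * 1789 - 1) / 2. *)
exists (31 * 1789 * m%:Z + 3081 * 9 + r).
by rewrite exprD -muln2 intS PoszM; ring.
Qed.

Lemma odd_part3_exact2 s t k : odd t ->
  exact2 (s + 4) (3 ^+ (4 * (k + 2 ^ s * t))%N - 3 ^+ (4 * k)%N).
Proof.
move=> odd_t; have {odd_t} [m -> {t}] : exists m, t = m.*2.+1 by exists t./2; lia.
rewrite !exprM.
have [r def3] := expr_diff_linear 3 s m.*2.+1 k 5.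
have ->: (3%:R : int) ^+ 4 = 1 + 2 ^+ 4 * 5 by ring.
rewrite def3.
exists (5 * m%:Z + 2 + 4 * r).
rewrite !exprD -[3.*2.+1]/(4 + 3)%N !exprD -muln2 intS PoszM; ring.
Qed.

Lemma exact2B v w x y : exact2 v x -> exact2 w y -> (v < w)%N -> exact2 v (x - y).
Proof.
by move=> xv yw ltvw; apply: exact2D xv (exact2_dvd _ _ _ (exact2N _ _ yw) ltvw).
Qed.

(** * Passage to integers and comparison of valuations *)

Lemma stirling2_3z n : (0 < n)%N ->
  3`!%:Z * (stirling2 n 3)%:Z = 3 ^+ n - 3 * 2 ^+ n + 3.
Proof.
move=> n_gt0; move: 3`! (stirling2_3 _ n_gt0) => f /(congr1 (GRing.natmul (1 : int))).
rewrite !(natrM, natrD, natrX) -[f%:Z]natz -[Posz (stirling2 n 3)]natz => eqS.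
by apply: (addIr (3 * 2 ^+ n)); rewrite eqS; ring.
Qed.

Lemma stirling2_7z n : (0 < n)%N ->
  7`!%:Z * (stirling2 n 7)%:Z =
    7 ^+ n + 21 * 5 ^+ n + 35 * 3 ^+ n
    - (7 * 6 ^+ n + 35 * 4 ^+ n + 21 * 2 ^+ n) + 7.
Proof.
move=> n_gt0; move: 7`! (stirling2_7 _ n_gt0) => f /(congr1 (GRing.natmul (1 : int))).
rewrite !(natrM, natrD, natrX) -[f%:Z]natz -[Posz (stirling2 n 7)]natz => eqS.
by apply: (addIr (7 * 6 ^+ n + 35 * 4 ^+ n + 21 * 2 ^+ n)); rewrite !addrA eqS; ring.
Qed.

Lemma stirling2_diff_neq0 k m n : (1 < k <= m)%N -> (m < n)%N ->
  (stirling2 n k)%:Z - (stirling2 m k)%:Z != 0.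
Proof. by move=> lekm ltmn; have := ltn_stirling2 _ _ _ lekm ltmn; lia. Qed.

Lemma subn_eq_pow2_odd a b : (b < a)%N ->
  exists2 t, odd t & a = (b + 2 ^ nu2 (a%:Z - b%:Z) * t)%N.
Proof.
move=> ltba; have [|t co_t def_ab] := @pfactor_coprime 2 (a - b) isT.
  by rewrite subn_gt0.
exists t; first by rewrite coprime2n in co_t.
by rewrite /nu2 distnEl 1?ltnW // mulnC -def_ab subnKC // ltnW.
Qed.

Lemma fact3_exact2 : exact2 1 3`!%:Z.
Proof. by exists 1. Qed.

Lemma fact7_exact2 : exact2 4 7`!%:Z.
Proof. by exists 157; rewrite !factS fact0 !PoszM; ring. Qed.

Local Close Scope ring_scope.

Theorem theorem1p2 (a b n : nat) (hb : 1 <= b) (hab : b < a) :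
  (2 <= n ->
    let v := nu2 ((stirling2 (a * 2 ^ n) 3)%:Z - (stirling2 (b * 2 ^ n) 3)%:Z)%R in
    let w := nu2 (a%:Z - b%:Z)%R in
    [/\ n + 2 + w < b * 2 ^ n -> v = n + 1 + w,
        b * 2 ^ n = n + 2 + w -> n + 1 + w < v
      & b * 2 ^ n < n + 2 + w -> v = b * 2 ^ n - 1])
  /\
  (3 <= n ->
    let v := nu2 ((stirling2 (a * 2 ^ n) 7)%:Z - (stirling2 (b * 2 ^ n) 7)%:Z)%R in
    let w := nu2 (a%:Z - b%:Z)%R in
    [/\ n + 3 + w < b * 2 ^ n -> v = n + 1 + w,
        b * 2 ^ n = n + 3 + w -> n + 1 + w < v
      & b * 2 ^ n < n + 3 + w -> v = b * 2 ^ n - 2]).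
Proof.
have [t odd_t def_a] := subn_eq_pow2_odd _ _ hab.
(* Used with c = 4 and c = 8, to put the exponents in the form required by the odd-part lemmas. *)
have A_def m c : m <= n -> c = 2 ^ m ->
    a * 2 ^ n = c * (b * 2 ^ (n - m) + 2 ^ (n - m + nu2 (a%:Z - b%:Z)%R) * t).
  move=> lemn ->; rewrite {1}def_a mulnDr mulnDl expnD -{1 2}(subnKC lemn) expnD.
  by congr (_ + _); ring.
have B_def m c : m <= n -> c = 2 ^ m -> b * 2 ^ n = c * (b * 2 ^ (n - m)).
  by move=> lemn ->; rewrite -{1}(subnKC lemn) expnD; ring.
have ltBA : b * 2 ^ n < a * 2 ^ n by rewrite ltn_pmul2r ?expn_gt0.
have leB m : m <= n -> 2 ^ m <= b * 2 ^ n.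
  by move=> lemn; rewrite -[leqLHS]mul1n leq_mul // leq_exp2l.
split=> le_n v w.
  have B4 : 4 <= b * 2 ^ n := leB 2 le_n.
  have neqD := stirling2_diff_neq0 3 _ _ (ltnW B4) ltBA.
  have exU := odd_part3_exact2 (n - 2 + w) t (b * 2 ^ (n - 2)) odd_t.
  rewrite -(A_def 2) // -(B_def 2) // in exU.
  have exE N : exact2 N (3 * 2 ^+ N)%R by exists 1%R; ring.
  have exV := exact2B _ _ _ _ (exE _) (exE _) ltBA.
  (* The valuations compared are n + 2 + w and b * 2^n; dividing by 3! lowers both by 1. *)
  have [| | |lt eq gt] := nu2_trichotomy _ _ _ _ _ _ _ fact3_exact2 neqD _ exU _ exV.
  - by rewrite addn_gt0 orbT.
  - exact: ltnW (ltnW (ltnW B4)).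
  - by rewrite mulrBr !stirling2_3z; [ring | lia | lia].
  by split=> cmp; [rewrite [v]lt | apply: leq_trans (eq _) | rewrite [v]gt];
    move: cmp B4 le_n; clear; lia.
have B8 : 8 <= b * 2 ^ n := leB 3 le_n.
have evN c : ~~ odd (c * 2 ^ n) by rewrite oddM oddX orbF negb_and (gtn_eqF (leq_trans _ le_n)) ?orbT.
have neqD := stirling2_diff_neq0 7 _ _ (ltnW B8) ltBA.
have exU := odd_part7_exact2 (n - 3 + w) t (b * 2 ^ (n - 3)) odd_t.
rewrite /= -(A_def 3) // -(B_def 3) // in exU.
have exE c (le8 : 8 <= c * 2 ^ n) := even_part7_exact2 _ (leq_trans (isT : 4 <= 8) le8) (evN c).
have exV := exact2B _ _ _ _ (exE b B8) (exE a (leq_trans B8 (ltnW ltBA))) ltBA.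
(* The valuations compared are n + 5 + w and b * 2^n + 2; dividing by 7! lowers both by 4. *)
have [| | |lt eq gt] := nu2_trichotomy _ _ _ _ _ _ _ fact7_exact2 neqD _ exU _ exV.
- by rewrite ltn_addl.
- by move: B8; clear; lia.
- by rewrite mulrBr !stirling2_7z; [ring | lia | lia].
by split=> cmp; [rewrite [v]lt | apply: leq_trans (eq _) | rewrite [v]gt];
  move: cmp B8 le_n; clear; lia.
Qed.
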